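(* There are absolute constants $C,C'>0$ such that for every $n\ge 2$ and every connected simple undirected graph $G_0$ on $n$ nodes, the triangulation process started from $G_0$ satisfies: with probability at least $1-C'\frac{\log n}{n}$, the graph $G_T$ with $T=\lceil C n\log^2 n\rceil$ is the complete graph on the $n$ nodes.
   Context: Triangulation process: $G_0$ is a connected simple undirected graph on an $n$-node vertex set $V$. Given $G_t$, in round $t$ every node $x$ independently picks two neighbors $v,w$ of $x$ in $G_t$, independently and uniformly at random, and the edge $\{v,w\}$ is added (nothing happens if $v=w$ or the edge already exists); $G_{t+1}$ is $G_t$ together with all edges added in round $t$. Edges are never removed. *)

(* Defs.v *)
From HB Require Import structures.
From Stdlib Require Import Reals.
From mathcomp Require Import all_boot.

Set Implicit Arguments.
Unset Strict Implicit.
Unset Printing Implicit Defensive.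

Lemma Rplus_assoc' : associative Rplus.
Proof. by move=> a b c; rewrite Rplus_assoc. Qed.
Lemma Rmult_assoc' : associative Rmult.
Proof. by move=> a b c; rewrite Rmult_assoc. Qed.
HB.instance Definition _ := Monoid.isComLaw.Build R R0 Rplus
  Rplus_assoc' Rplus_comm Rplus_0_l.
HB.instance Definition _ := Monoid.isComLaw.Build R R1 Rmult
  Rmult_assoc' Rmult_comm Rmult_1_l.

(* A graph on the vertex set 'I_n is given by its set of ordered adjacent
   pairs (x,y); undirected simple graphs are the symmetric irreflexive ones. *)
Definition graph (n : nat) := {set 'I_n * 'I_n}.

Definition simple_graph n (G : graph n) : Prop :=
  (forall x : 'I_n, (x, x) \notin G) /\
  (forall x y : 'I_n, ((x, y) \in G) = ((y, x) \in G)).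

Definition connected_graph n (G : graph n) : Prop :=
  forall x y : 'I_n, connect (fun u v => (u, v) \in G) x y.

Definition complete_graph n (G : graph n) : bool :=
  [forall x : 'I_n, forall y : 'I_n, (x != y) ==> ((x, y) \in G)].

Definition nbhd n (G : graph n) (x : 'I_n) : {set 'I_n} := [set y | (x, y) \in G].

Definition deg n (G : graph n) (x : 'I_n) : nat := #|nbhd G x|.

(* Probability that node x picks the ordered pair p = (v,w) of neighbours:
   v and w are independent uniform neighbours of x.  A node with no
   neighbour picks nothing, encoded as the (void) pair (x,x). *)
Definition pick_prob n (G : graph n) (x : 'I_n) (p : 'I_n * 'I_n) : R :=
  if deg G x == 0%N then (if p == (x, x) then R1 else R0)
  else if (p.1 \in nbhd G x) && (p.2 \in nbhd G x)
       then Rinv (Rmult (INR (deg G x)) (INR (deg G x)))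
       else R0.

Definition choice_prob n (G : graph n) (c : {ffun 'I_n -> 'I_n * 'I_n}) : R :=
  \big[Rmult/R1]_(x : 'I_n) pick_prob G x (c x).

Definition round n (G : graph n) (c : {ffun 'I_n -> 'I_n * 'I_n}) : graph n :=
  G :|: [set p : 'I_n * 'I_n | [exists x : 'I_n,
          ((c x).1 != (c x).2) && ((p == c x) || (p == ((c x).2, (c x).1)))]].

Fixpoint prob_complete n (t : nat) (G : graph n) : R :=
  match t with
  | 0 => if complete_graph G then R1 else R0
  | t'.+1 => \big[Rplus/R0]_(c : {ffun 'I_n -> 'I_n * 'I_n})
               (Rmult (choice_prob G c) (prob_complete t' (round G c)))
  end.

(* Main.v *)
(* Fix the graph G at the start of a phase, with minimum degree d, and a node u
   of degree less than 9d/8.  Call B the closed neighbourhood of u, possibly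
   enlarged by fewer than d/4 nodes, and out(v) the number of neighbours of v
   outside B.  A node x adjacent to v introduces v to a given other neighbour
   of x with probability 2/deg(x)^2, so any family of neighbours of v having a
   constant fraction of their own neighbours outside B and not adjacent to v
   makes out(v) grow by a factor 1 + Omega(1/n) per round; hence
   E[1/(out(v)+1)] contracts by 1 - Omega(1/n), and Markov's inequality gives
   out(v) >= d/8 within O(n log n) rounds, except with probability O(1/n^2).

   Let F0 be the nodes outside N[u] with fewer than d/2 neighbours outside N[u];
   each of them has at least d/2 neighbours in N(u).
   - If |F0| >= d/4, the nodes of N(u) introduce u to F0 fast enough, with
     B = N[u].
   - If |F0| < d/4, take B = N[u] + F0; nodes outside B have at least d/4
     neighbours outside B.  When B is not everything, some y in B has an edge
     leaving B.  Then out(y) grows to d/8; a neighbour x of y inherits this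
     because y introduces x to a node outside B, and so does u after x.  When
     B is everything, n <= 3d and u is linked to F0 directly.
   In all cases u gains d/8 neighbours or becomes adjacent to all nodes.  A union
   bound over u makes the minimum degree grow by 9/8 in O(n log n) rounds, and
   O(log n) such phases complete the graph. *)
Require Import Defs.
From HB Require Import structures.
From Stdlib Require Import Reals.
From Stdlib Require Lra.
From mathcomp Require Import all_boot all_order all_algebra.
From mathcomp Require Import Rstruct.
From mathcomp Require Import ring lra zify.

Set Implicit Arguments.
Unset Strict Implicit.
Unset Printing Implicit Defensive.

Import Order.TTheory GRing.Theory Num.Theory.

(** * The process as an expectation operator, and failure probabilities *)

Section Process.

Local Open Scope ring_scope.

Variables (R : realFieldType) (n : nat).
Implicit Types (G H : graph n) (x y z u v : 'I_n) (A B W Z : {set 'I_n}).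
Implicit Types (c : {ffun 'I_n -> 'I_n * 'I_n}) (f g : graph n -> R).

(** Copy of [pick_prob] over an arbitrary ordered field: the probabilistic part is purely algebraic,
    and real analysis enters only when the numbers of phases and rounds are chosen. *)
Definition pickR G x (p : 'I_n * 'I_n) : R :=
  if deg G x == 0%N then (if p == (x, x) then 1 else 0)
  else if (p.1 \in nbhd G x) && (p.2 \in nbhd G x)
       then ((deg G x)%:R * (deg G x)%:R)^-1
       else 0.

Definition weight G c : R := \prod_x pickR G x (c x).

(** One-step transition operator on observables: [iter t expect f G] is the expectation of [f] on
    the graph reached from [G] after [t] rounds. *)
Definition expect f G : R := \sum_c weight G c * f (round G c).

Lemma pickR_ge0 G x p : 0 <= pickR G x p.
Proof.
rewrite /pickR; case: ifP => _; first by case: ifP.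
by case: ifP => // _; rewrite invr_ge0 mulr_ge0 ?ler0n.
Qed.

Lemma sum_pickR G x : \sum_p pickR G x p = 1.
Proof.
rewrite /pickR; case: eqP => [_|/eqP d0].
  by rewrite -big_mkcond big_pred1_eq.
rewrite -big_mkcond /= -(pair_big (mem (nbhd G x)) (mem (nbhd G x))
  (fun _ _ => ((deg G x)%:R * (deg G x)%:R)^-1)) /=.
rewrite !sumr_const -/(deg G x) -[LHS]mulr_natr -[X in X * _]mulr_natr -mulrA mulVf //.
by rewrite mulf_neq0 // pnatr_eq0.
Qed.

Lemma weight_ge0 G c : 0 <= weight G c.
Proof. by apply: prodr_ge0 => x _; apply: pickR_ge0. Qed.

Lemma sum_weight_prod G (h : 'I_n -> 'I_n * 'I_n -> R) :
  \sum_c weight G c * \prod_x h x (c x) = \prod_x \sum_p pickR G x p * h x p.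
Proof.
by rewrite bigA_distr_bigA; apply: eq_bigr => c _; rewrite -big_split.
Qed.

Lemma sum_weight G : \sum_c weight G c = 1.
Proof.
rewrite -(bigA_distr_bigA (pickR G)); apply: big1 => x _; exact: sum_pickR.
Qed.

Lemma ler_expect f g G :
  (forall c, f (round G c) <= g (round G c)) -> expect f G <= expect g G.
Proof. by move=> fg; apply: ler_sum => c _; rewrite ler_wpM2l ?weight_ge0. Qed.

Lemma expectD f g G : expect (fun H => f H + g H) G = expect f G + expect g G.
Proof. by rewrite -big_split; apply: eq_bigr => c _; rewrite mulrDr. Qed.

Lemma expectZ a f G : expect (fun H => a * f H) G = a * expect f G.
Proof. by rewrite mulr_sumr; apply: eq_bigr => c _; rewrite mulrCA. Qed.

Lemma expect_cst a G : expect (fun=> a) G = a.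
Proof. by rewrite /expect -mulr_suml sum_weight mul1r. Qed.

(** Closure is asked for every [c], even of weight zero, so the support of the distribution never
    has to be discussed. *)
Definition stable (I : graph n -> Prop) := forall G c, I G -> I (round G c).

Lemma ler_expectn (I : graph n -> Prop) t f g G : stable I ->
  (forall H, I H -> f H <= g H) -> I G ->
  iter t expect f G <= iter t expect g G.
Proof.
move=> stI fg; elim: t G => [|t IHt] G IG; first exact: fg.
by rewrite !iterS; apply: ler_expect => c; apply/IHt/stI.
Qed.

Lemma expectnD t f g G :
  iter t expect (fun H => f H + g H) G
    = iter t expect f G + iter t expect g G.
Proof.
elim: t G => // t IHt G; rewrite !iterS -expectD.
by apply: eq_bigr => c _; rewrite IHt.
Qed.

Lemma expectn_cst t a G : iter t expect (fun=> a) G = a.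
Proof.
elim: t G => // t IHt G; rewrite iterS -[RHS](expect_cst a G).
by apply: eq_bigr => c _; rewrite IHt.
Qed.

Lemma expectn_sum (J : finType) t (F : J -> graph n -> R) G :
  iter t expect (fun H => \sum_j F j H) G = \sum_j iter t expect (F j) G.
Proof.
elim: t G => // t IHt G; rewrite iterS.
under [RHS]eq_bigr do rewrite iterS.
rewrite /expect exchange_big; apply: eq_bigr => c _ /=.
by rewrite IHt mulr_sumr.
Qed.

(** Probability that [D] is false after exactly [t] rounds; for an absorbing [D], that it has not
    been reached so far. *)
Definition fails t (D : graph n -> bool) G : R :=
  iter t expect (fun H => (~~ D H)%:R) G.

Lemma fails_absorbing (I : graph n -> Prop) (D : graph n -> bool) t G :
  stable I -> (forall H c, I H -> D H -> D (round H c)) ->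
  I G -> D G -> fails t D G = 0.
Proof.
move=> stI stD; rewrite /fails; elim: t G => [|t IHt] G IG DG; first by rewrite /= DG.
rewrite iterS; apply: big1 => c _; rewrite IHt ?mulr0 //; first exact: stI.
exact: stD.
Qed.

(** Markov property and union bound: given the graph after [s] rounds, the later failure probability
    is at most [b] if [D1] holds there, and at most 1 otherwise. *)
Lemma fails_seq (I : graph n -> Prop) (D1 D2 : graph n -> bool) s t (a b : R) G :
  stable I -> 0 <= b -> I G -> fails s D1 G <= a ->
  (forall H, I H -> D1 H -> fails t D2 H <= b) ->
  fails (s + t) D2 G <= a + b.
Proof.
move=> stI b0 IG D1a D2b; rewrite /fails iterD.
apply: (@le_trans _ _ (iter s expect (fun H => (~~ D1 H)%:R + b) G)); last first.
  by rewrite expectnD expectn_cst lerD2r.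
apply: (ler_expectn (I := I)) => // H IH.
case D1H: (D1 H) => /=; first by rewrite add0r; exact: D2b.
rewrite -[iter t _ _ _]addr0 lerD //.
rewrite -[X in _ <= X](expectn_cst t 1 H).
apply: (ler_expectn (I := I)) => // K _; by rewrite lern1 leq_b1.
Qed.

(** Markov's inequality for a contracting potential. Contraction is asked only while [D] is false:
    once true, [D] persists and contributes no failure. *)
Lemma fails_drift (I : graph n -> Prop) (D : graph n -> bool) (phi : graph n -> R)
    (r : R) t G :
  stable I -> (forall H c, I H -> D H -> D (round H c)) -> r <= 1 ->
  (forall H, 0 <= phi H) -> (forall H, I H -> ~~ D H -> 1 <= phi H) ->
  (forall H, I H -> ~~ D H -> expect phi H <= (1 - r) * phi H) ->
  I G -> fails t D G <= (1 - r) ^+ t * phi G.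
Proof.
move=> stI stD r1 phi0 phi1 drift; elim: t G => [|t IHt] G IG.
  rewrite expr0 mul1r /fails /=; case DG: (D G) => //=.
  by apply: phi1; rewrite ?DG.
have [DG|nDG] := boolP (D G).
  by rewrite (fails_absorbing _ stI stD) // mulr_ge0 // exprn_ge0 // subr_ge0.
rewrite /fails iterS exprSr -mulrA.
apply: (@le_trans _ _ (expect (fun H => (1 - r) ^+ t * phi H) G)).
  by apply: ler_expect => c; apply/IHt/stI.
by rewrite expectZ ler_wpM2l ?drift // exprn_ge0 // subr_ge0.
Qed.

(** Algebraic substitute for the exponential estimate: the product is at most [1 / (1 + S)] with [S]
    the sum, because [(1 - q) * (1 + q + S) <= 1 + S]. *)
Lemma prod_1subr_sum (J : eqType) (s : seq J) (P : pred J) (q : J -> R) :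
  (forall j, P j -> 0 <= q j <= 1) ->
  (\prod_(j <- s | P j) (1 - q j)) * (1 + \sum_(j <- s | P j) q j) <= 1.
Proof.
move=> q01.
have S0 l : 0 <= \sum_(j <- l | P j) q j.
  by apply: sumr_ge0 => j /q01 /andP[].
have P0 l : 0 <= \prod_(j <- l | P j) (1 - q j).
  by apply: prodr_ge0 => j /q01 /andP[_ ?]; rewrite subr_ge0.
elim: s => [|j s IHs]; first by rewrite !big_nil addr0 mulr1.
rewrite !big_cons; case: ifP => // /q01 /andP[q0 q1].
apply: le_trans IHs; rewrite -mulrA mulrCA ler_wpM2l //.
have := S0 s; nra.
Qed.

End Process.

(** * Introductions received by one node in one round *)

Section Growth.

Local Open Scope ring_scope.

Variables (R : realFieldType) (n : nat).
Implicit Types (G H : graph n) (x y z u v : 'I_n) (A B W Z : {set 'I_n}).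
Implicit Types (c : {ffun 'I_n -> 'I_n * 'I_n}).

Lemma sum_pickR_avoid G v x z : v != z -> v \in nbhd G x ->
  \sum_p pickR R G x p * ((p != (v, z)) && (p != (z, v)))%:R
    = 1 - (z \in nbhd G x)%:R * 2 / (deg G x)%:R ^+ 2.
Proof.
move=> vz vx.
have d0 : deg G x != 0%N by rewrite -lt0n card_gt0; apply/set0Pn; exists v.
have pick1 p : \sum_q pickR R G x q * (q == p)%:R = pickR R G x p.
  rewrite (bigD1 p) //= eqxx mulr1 big1 ?addr0 // => q /negbTE ->.
  by rewrite mulr0.
transitivity (\sum_p (pickR R G x p - pickR R G x p * (p == (v, z))%:R
                      - pickR R G x p * (p == (z, v))%:R)).
  apply: eq_bigr => p _; have [->|/=] := eqVneq p (v, z).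
    by rewrite xpair_eqE (negbTE vz) /= mulr0 mulr1 subrr subr0.
  by move=> _; case: eqVneq => /= _; rewrite ?mulr0 ?mulr1 ?subr0 ?subrr.
rewrite !sumrB !pick1 sum_pickR /pickR (negbTE d0) /= vx /= andbT.
by case: (z \in _) => /=; rewrite ?expr2; ring.
Qed.

Definition hit W v c z := [exists x in W, (c x == (v, z)) || (c x == (z, v))].

(** The picks are independent, so [z] is missed with probability [\prod (1 - q x) <= 1 / (1 + S)],
    where [S = \sum q x]. Since [S <= 8], a hit has probability at least [S / 9]; the factor 2
    counts the two orders of the pair. *)
Lemma hit_prob G W v z d : (0 < d)%N -> v != z -> W \subset nbhd G v ->
  simple_graph G -> (#|W| <= 4 * d)%N -> (forall x, d <= deg G x)%N ->
  2 / 9 * \sum_(x in W) (z \in nbhd G x)%:R / (deg G x)%:R ^+ 2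
    <= \sum_c weight R G c * (hit W v c z)%:R.
Proof.
move=> d0 vz WG [_ symG] Wd mind.
pose q x : R := (z \in nbhd G x)%:R * 2 / (deg G x)%:R ^+ 2.
have vN x : x \in W -> v \in nbhd G x.
  by move=> /(subsetP WG); rewrite !inE symG.
pose ok x (p : 'I_n * 'I_n) : R :=
  if x \in W then ((p != (v, z)) && (p != (z, v)))%:R else 1.
have okE c : (hit W v c z)%:R = 1 - \prod_x ok x (c x).
  have [/exists_inP[x xW cx]|/exists_inPn no] := boolP (hit W v c z).
    by rewrite (bigD1 x) //= /ok xW -negb_or cx /= mul0r subr0.
  rewrite big1 ?subrr // => x _; rewrite /ok; case: ifP => // /no.
  by rewrite negb_or => ->.
under [X in _ <= X]eq_bigr do rewrite okE mulrBr mulr1.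
rewrite sumrB sum_weight sum_weight_prod.
have -> : \prod_x \sum_p pickR R G x p * ok x p = \prod_(x in W) (1 - q x).
  rewrite [RHS]big_mkcond; apply: eq_bigr => x _ /=; rewrite /ok.
  case: ifP => xW; first by rewrite sum_pickR_avoid ?vN.
  by under eq_bigr do rewrite mulr1; exact: sum_pickR.
have dR x : (d%:R : R) <= (deg G x)%:R by rewrite ler_nat.
have d0R : (1 : R) <= d%:R by rewrite ler1n.
have q0 x : 0 <= q x by rewrite /q !mulr_ge0 ?invr_ge0 ?exprn_ge0 ?ler0n.
have q1 x : x \in W -> q x <= 1.
  move=> xW; rewrite /q; case zx: (z \in _); last by rewrite !mul0r.
  have : (2 <= deg G x)%N.
    have <- : #|[set v; z]| = 2%N by rewrite cards2 vz.
    apply: subset_leq_card.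
    by apply/subsetP => w /set2P[] ->; rewrite ?vN.
  rewrite -(ler_nat R) => d2.
  by rewrite mul1r ler_pdivrMr ?mul1r ?expr2; nra.
have P1 := @prod_1subr_sum R _ (index_enum 'I_n) (mem W) q
  (fun x xW => introT andP (conj (q0 x) (q1 x xW))).
(* At most [4 * d] terms, each at most [2 / d ^ 2], sum to at most [8 / d]. *)
have S8 : \sum_(x in W) q x <= 8.
  apply: (@le_trans _ _ (\sum_(x in W) 2 / d%:R ^+ 2)).
    apply: ler_sum => x xW; rewrite /q ler_pM ?invr_ge0 ?exprn_ge0 ?mulr_ge0 ?ler0n //.
      by case: (z \in _); rewrite ?mul1r ?mul0r.
    rewrite lef_pV2 ?posrE ?exprn_gt0 ?ltr0n ?(leq_trans d0) //.
    by rewrite lerXn2r ?nnegrE ?ler0n.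
  rewrite sumr_const -[X in X <= _]mulr_natr mulrAC ler_pdivrMr; last first.
    by rewrite exprn_gt0 // ltr0n.
  have : (#|W|%:R : R) <= 4 * d%:R by rewrite -natrM ler_nat.
  rewrite expr2; nra.
have S0 : 0 <= \sum_(x in W) q x by apply: sumr_ge0.
have -> : 2 / 9 * \sum_(x in W) (z \in nbhd G x)%:R / (deg G x)%:R ^+ 2
          = 9^-1 * \sum_(x in W) q x.
  by rewrite !mulr_sumr; apply: eq_bigr => x _; rewrite /q; ring.
move: P1 S8 S0; set P := \prod_(x in W) _; set S := \sum_(x in W) q x.
move=> P1 S8 S0; have -> : 9^-1 * S = 1 - (1 - S / 9) by ring.
rewrite lerD2l lerN2; nra.
Qed.

Definition hits W v Z c := [set z in Z | hit W v c z].

Lemma sum_hits G W v Z d : (0 < d)%N -> v \notin Z -> W \subset nbhd G v ->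
  simple_graph G -> (#|W| <= 4 * d)%N -> (forall x, d <= deg G x)%N ->
  2 / 9 * \sum_(x in W) #|nbhd G x :&: Z|%:R / (deg G x)%:R ^+ 2
    <= \sum_c weight R G c * #|hits W v Z c|%:R.
Proof.
move=> d0 vZ WG sG Wd mind.
have cardR (P : pred 'I_n) : (#|[set z in Z | P z]|%:R : R) = \sum_(z in Z) (P z)%:R.
  by rewrite -sum1dep_card natr_sum [RHS]big_mkcond [LHS]big_mkcond /=;
     apply: eq_bigr => z _; case: (z \in Z) => //=; case: (P z).
have -> : \sum_(x in W) #|nbhd G x :&: Z|%:R / (deg G x)%:R ^+ 2
   = \sum_(z in Z) \sum_(x in W) (z \in nbhd G x)%:R / (deg G x)%:R ^+ 2 :> R.
  rewrite exchange_big; apply: eq_bigr => x _ /=.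
  rewrite -mulr_suml; congr (_ / _).
  by rewrite -cardR; congr (_%:R); apply: eq_card => z; rewrite !inE andbC.
under [X in _ <= X]eq_bigr do rewrite cardR mulr_sumr.
rewrite [X in _ <= X]exchange_big mulr_sumr /=; apply: ler_sum => z zZ.
by apply: hit_prob d0 _ WG sG Wd mind; apply: contraNneq vZ => ->.
Qed.

(** A node picks one pair per round, so it introduces [v] to at most one node; [other] maps it to
    that node. *)
Lemma card_hits W v Z c : v \notin Z -> (#|hits W v Z c| <= #|W|)%N.
Proof.
move=> vZ; pose other x := if (c x).1 == v then (c x).2 else (c x).1.
apply: leq_trans (leq_imset_card other W); apply: subset_leq_card.
apply/subsetP => z; rewrite inE => /andP[zZ /exists_inP[x xW cx]].
apply/imsetP; exists x => //; rewrite /other.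
case/orP: cx => /eqP -> /=; first by rewrite eqxx.
by case: eqP => // zv; rewrite -zv zZ in vZ.
Qed.

Lemma sub_round G c : G \subset round G c.
Proof. exact: subsetUl. Qed.

Lemma hits_round W v Z c G : v \notin Z -> hits W v Z c \subset nbhd (round G c) v.
Proof.
move=> vZ; apply/subsetP => z; rewrite !inE => /andP[zZ /exists_inP[x xW cx]].
apply/orP; right; apply/existsP; exists x.
have zv : z != v by apply: contraNneq vZ => <-.
by case/orP: cx => /eqP -> /=; rewrite ?eqxx ?orbT ?andbT // eq_sym.
Qed.

Lemma nbhdS G H x : G \subset H -> nbhd G x \subset nbhd H x.
Proof. by move=> /subsetP GH; apply/subsetP => y; rewrite !inE => /GH. Qed.

Definition out G B v := #|nbhd G v :\: B|.

(** Hits are counted away from [B :|: nbhd G v], hence are disjoint from the old outside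
    neighbours. *)
Lemma out_round G B W v c :
  v \in B ->
  (out G B v + #|hits W v (~: (B :|: nbhd G v)) c| <= out (round G c) B v)%N.
Proof.
move=> vB; set Z := ~: _.
have vZ : v \notin Z by rewrite !inE vB.
have := hits_round W c G vZ; set h := hits _ _ _ _ => hG.
have hZ z : z \in h -> z \in Z by rewrite inE => /andP[].
rewrite -cardsUI (_ : _ :&: _ = set0) ?cards0 ?addn0; last first.
  apply/setP => z; rewrite inE [RHS]inE; apply/negP => /andP[].
  by rewrite inE => /andP[_ zv] /hZ; rewrite !inE in zv *; rewrite zv orbT.
apply: subset_leq_card; apply/subsetP => z /setUP[] zh; rewrite inE.
  move: zh; rewrite inE => /andP[-> /=]; exact/subsetP/nbhdS/sub_round.
rewrite (subsetP hG) // andbT; move: (hZ z zh).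
by rewrite in_setC in_setU negb_or => /andP[].
Qed.

End Growth.

(** * Drift of the two potentials that drive a stage *)

Section Stages.

Local Open Scope ring_scope.

Variables (R : realFieldType) (n : nat).
Implicit Types (G H : graph n) (x y z u v w : 'I_n) (A B W X Z : {set 'I_n}).
Implicit Types (c : {ffun 'I_n -> 'I_n * 'I_n}) (I : graph n -> Prop).

Lemma outS G H B v : G \subset H -> (out G B v <= out H B v)%N.
Proof. by move=> GH; apply/subset_leq_card/setSD/nbhdS. Qed.

Lemma degS G H v : G \subset H -> (deg G v <= deg H v)%N.
Proof. by move=> GH; apply/subset_leq_card/nbhdS. Qed.

Lemma out_lt G B v : v \in B -> (out G B v < n)%N.
Proof.
move=> vB; rewrite -[X in (_ < X)%N]card_ord; apply: proper_card.
by apply/properP; split; [exact/subsetP | exists v => //; rewrite inE vB].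
Qed.

Lemma deg_le_out G B v : (deg G v <= #|B| + out G B v)%N.
Proof.
rewrite /deg -(cardsID B) addnC [X in (_ <= X)%N]addnC leq_add2l.
by apply/subset_leq_card/subsetIr.
Qed.

Definition fresh G B v x := #|nbhd G x :\: (B :|: nbhd G v)|.

(* Counting only introductions made by W caps the gain of a round by #|W|; on
   that range 1/(out + 1) decreases at least linearly in the gain. *)
Definition growing G B W v d : Prop :=
  (out G B v).+1%:R + #|W|%:R <=
  240 * \sum_(x in W) (fresh G B v x)%:R / ((fresh G B v x)%:R + 4 * d%:R) :> R.

(** Convexity: on the interval from 0 to [b], [1 / (a + s)] lies below its chord. *)
Lemma invr_addr_le (a b s : R) :
  0 < a -> 0 <= s <= b -> (a + s)^-1 <= a^-1 - (a * (a + b))^-1 * s.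
Proof.
move=> a0 /andP[s0 sb].
have as0 : 0 < a + s by rewrite ltr_pwDl.
have -> : (a + s)^-1 = a^-1 - (a * (a + s))^-1 * s.
  by field; rewrite !gt_eqF.
rewrite lerD2l lerN2 ler_wpM2r // lef_pV2 ?posrE ?mulr_gt0 //.
  by rewrite ler_pM2l // lerD2l.
by rewrite ltr_pwDl // (le_trans s0).
Qed.

(** Let [a = out + 1], [b = #|W|] and [E] the expected number of hits. The chord bound gives a
    decrease of at least [E / (a * (a + b))], and [growing] forces [E >= (a + b) / (1080 * n)]. *)
Lemma growth_drift G B W v d : (0 < d)%N -> v \in B -> (#|B| <= 3 * d)%N ->
  W \subset nbhd G v -> simple_graph G -> (forall x, d <= deg G x)%N ->
  (8 * out G B v < d)%N -> growing G B W v d ->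
  expect (fun H => (out H B v).+1%:R^-1) G
    <= (1 - (1080 * n%:R)^-1) * ((out G B v).+1%:R^-1 : R).
Proof.
move=> d0 vB B3 WG sG mind p8 grow.
have n0 : (0 : R) < n%:R by rewrite ltr0n (leq_trans _ (ltn_ord v)).
have d0R : (0 : R) < d%:R by rewrite ltr0n.
set Z := ~: (B :|: nbhd G v).
have vZ : v \notin Z by rewrite !inE vB.
have W4 : (#|W| <= 4 * d)%N.
  have := subset_leq_card WG; have := deg_le_out G B v; rewrite /deg; lia.
have := sum_hits R d0 vZ WG sG W4 mind.
set E := \sum_c _ => Eg.
(* One factor of [deg ^ 2] is bounded by [n], the other by [fresh + 4 * d]: the set [B :|: nbhd G v]
   has at most [3 * d + d / 8] nodes. *)
have fresh_deg x : (fresh G B v x)%:R / ((fresh G B v x)%:R + 4 * d%:R)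
    <= n%:R * (#|nbhd G x :&: Z|%:R / (deg G x)%:R ^+ 2) :> R.
  rewrite -setDE -/(fresh G B v x); set o := fresh _ _ _ _.
  have : (deg G x <= o + 4 * d)%N.
    have := deg_le_out G (B :|: nbhd G v) x; have := deg_le_out G B v.
    rewrite /out -/(fresh G B v x) -/o.
    have := cardsU B (nbhd G v); rewrite -(cardsID B (nbhd G v)).
    rewrite setIC -/(out G B v); lia.
  rewrite -(ler_nat R) natrD natrM => degR.
  have degn : ((deg G x)%:R : R) <= n%:R.
    by rewrite ler_nat -[X in (_ <= X)%N]card_ord max_card.
  have deg0 : (0 : R) < (deg G x)%:R by rewrite ltr0n (leq_trans d0).
  have o0 : (0 : R) <= o%:R by [].
  rewrite mulrCA ler_wpM2l // expr2 invfM mulrA.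
  rewrite -[X in X <= _]mul1r ler_pM // ?invr_ge0 ?addr_ge0 ?mulr_ge0 //.
    by rewrite ler_pdivlMr ?mul1r.
  by rewrite lef_pV2 ?posrE //; nra.
(* 1080 is the 240 of [growing] times 9 / 2, the inverse of the hit constant. *)
have {}Eg : (out G B v).+1%:R + #|W|%:R <= 1080 * n%:R * E.
  apply: le_trans grow _; apply: (@le_trans _ _ (240 * (n%:R * (9 / 2 * E)))); last by lra.
  rewrite ler_wpM2l //.
  apply: (@le_trans _ _ (n%:R * \sum_(x in W) (#|nbhd G x :&: Z|%:R / (deg G x)%:R ^+ 2))).
    by rewrite mulr_sumr; apply: ler_sum.
  by rewrite ler_wpM2l ?ler0n //; lra.
set a : R := (out G B v).+1%:R; set b : R := #|W|%:R in Eg *.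
have a0 : 0 < a by rewrite ltr0n.
have b0 : 0 <= b by [].
apply: (@le_trans _ _ (a^-1 - (a * (a + b))^-1 * E)).
  rewrite /E mulr_sumr -[X in X - _](expect_cst a^-1 G) /expect -sumrB.
  apply: ler_sum => c _; rewrite [X in _ - X]mulrCA -mulrBr ler_wpM2l ?weight_ge0 //.
  have := out_round G W c vB; have := @card_hits _ W v Z c vZ; rewrite -/Z.
  set g := #|hits _ _ _ _|; rewrite -(ler_nat R) -/b => gb pg.
  have g0 : (0 : R) <= g%:R by [].
  apply: (@le_trans _ _ (a + g%:R)^-1).
    rewrite lef_pV2 ?posrE ?ltr0n ?ltr_pwDl //.
    by rewrite /a -natrD ler_nat addSn ltnS.
  by apply: invr_addr_le; rewrite // g0.
have key : (1080 * n%:R)^-1 <= (a + b)^-1 * E.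
  rewrite ler_pdivlMl ?ltr_pwDl // ler_pdivrMr ?mulr_gt0 //.
  by rewrite [X in _ <= X]mulrC.
rewrite mulrBl mul1r lerD2l lerN2 [X in _ <= X * E]invfM -mulrA.
by rewrite [X in X <= _]mulrC ler_wpM2l // invr_ge0 ltW.
Qed.

(** The leading [n] bounds the initial value of both potentials: [n / (out + 1)] and the number of
    missing neighbours. *)
Definition stage_failure t : R := n%:R * (1 - (1080 * n%:R)^-1) ^+ t.

Lemma rate_le1 (v : 'I_n) : (1080 * n%:R)^-1 <= 1 :> R.
Proof.
have : (1 : R) <= n%:R by rewrite ler1n (leq_trans _ (ltn_ord v)).
move=> n1; rewrite invf_le1; lra.
Qed.

(** Drift of the potential [n / (out + 1)]; it stays at least 1 because [v] itself lies in [B],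
    whence [out < n]. *)
Lemma growth_stage I d B v t G : stable I -> (0 < d)%N -> v \in B -> (#|B| <= 3 * d)%N ->
  (forall H, I H -> simple_graph H /\ forall x, (d <= deg H x)%N) ->
  (forall H, I H -> (8 * out H B v < d)%N ->
    exists2 W : {set 'I_n}, W \subset nbhd H v & growing H B W v d) ->
  I G -> fails R t (fun H => d <= 8 * out H B v)%N G <= stage_failure t.
Proof.
move=> stI d0 vB B3 I1 I2 IG.
have r1 := rate_le1 v; have n0 : (0 : R) <= n%:R by [].
apply: (@le_trans _ _ ((1 - (1080 * n%:R)^-1) ^+ t * (n%:R * (out G B v).+1%:R^-1))).
  apply: (fails_drift (phi := fun H => n%:R * (out H B v).+1%:R^-1) t stI) IG => //.
  - by move=> H c _ /leq_trans-> //; rewrite leq_mul2l /= outS // sub_round.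
  - by move=> H; rewrite mulr_ge0 ?invr_ge0.
  - by move=> H _ _; rewrite ler_pdivlMr ?ltr0n // mul1r ler_nat out_lt.
  move=> H IH; rewrite -ltnNge => p8; rewrite expectZ mulrCA ler_wpM2l //.
  have [W WH gr] := I2 H IH p8; have [sH mind] := I1 H IH.
  exact: growth_drift gr.
rewrite mulrC /stage_failure ler_wpM2r ?exprn_ge0 ?subr_ge0 //.
by rewrite ler_piMr // invf_le1 ?ltr0n // ler1n.
Qed.

(** Double counting of the edges between [X] and [Z]. *)
Lemma sum_nbhdC G X Z : simple_graph G ->
  (\sum_(x in X) #|nbhd G x :&: Z| = \sum_(z in Z) #|nbhd G z :&: X|)%N.
Proof.
case=> _ symG.
have cardE x A : (#|nbhd G x :&: A| = \sum_(y in A) ((x, y) \in G))%N.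
  rewrite -sum1_card big_mkcond [RHS]big_mkcond; apply: eq_bigr => y _.
  by rewrite !inE andbC; case: (y \in A) => //; case: (_ \in G).
under eq_bigr do rewrite cardE; under [RHS]eq_bigr do rewrite cardE.
rewrite exchange_big; apply: eq_bigr => z _; apply: eq_bigr => x _.
by rewrite symG.
Qed.

(** The 6 is 2 * 3, from [r * d <= 2 * S] and [N <= 3 * d]. The rate is weakened on purpose, so that
    filling and growth share one failure bound. *)
Lemma fill_rate (N r S : R) : 0 < N -> 0 <= S -> r * N <= 6 * S ->
  (1080 * N)^-1 * r <= 2 / 9 * (S / N ^+ 2).
Proof.
move=> N0 S0 rS; have SN : 0 <= S / N ^+ 2 by rewrite divr_ge0 // exprn_ge0 // ltW.
have rN : r / N <= 6 * (S / N ^+ 2).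
  rewrite mulrA ler_pdivlMr ?exprn_gt0 //.
  by have -> : r / N * N ^+ 2 = r * N by field; rewrite gt_eqF.
have -> : (1080 * N)^-1 * r = 1080^-1 * (r / N) by field; rewrite gt_eqF.
lra.
Qed.

(** The potential is the number of nodes not yet adjacent to [u]. Each shares at least [d / 2]
    neighbours with [u], whose degrees are at most [n <= 3 * d], so a fraction Omega(1/n) of it is
    expected to vanish per round. *)
Lemma fill_stage I d u t G : stable I -> (n <= 3 * d)%N ->
  (forall H, I H -> simple_graph H /\ forall x, (d <= deg H x)%N) ->
  (forall H w, I H -> w \notin u |: nbhd H u -> (d <= 2 * #|nbhd H w :&: nbhd H u|)%N) ->
  I G -> fails R t (fun H => n.-1 <= deg H u)%N G <= stage_failure t.
Proof.
move=> stI n3 I1 I2 IG.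
have r1 := rate_le1 u.
have n0 : (0 : R) < n%:R by rewrite ltr0n (leq_trans _ (ltn_ord u)).
have d0 : (0 < d)%N by have := ltn_ord u; lia.
apply: (@le_trans _ _ ((1 - (1080 * n%:R)^-1) ^+ t * (n.-1 - deg G u)%:R)); last first.
  rewrite mulrC /stage_failure ler_wpM2r ?exprn_ge0 ?subr_ge0 //.
  by rewrite ler_nat; lia.
apply: (fails_drift (phi := fun H => (n.-1 - deg H u)%:R) t stI) IG => //.
- by move=> H c _ /leq_trans-> //; rewrite degS // sub_round.
- by move=> H _; rewrite -ltnNge ler1n; lia.
move=> H IH _; have [sH mind] := I1 H IH.
set Z := ~: ([set u] :|: nbhd H u).
have uZ : u \notin Z by rewrite !inE eqxx.
have deg_u : (deg H u <= n)%N by rewrite -[X in (_ <= X)%N]card_ord max_card.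
have ZE : #|Z| = (n.-1 - deg H u)%N.
  by rewrite /Z cardsCs setCK card_ord cardsU1 inE sH.1 /deg /= subnDA subn1.
have W4 : (#|nbhd H u| <= 4 * d)%N by rewrite -/(deg H u); lia.
have := sum_hits R d0 uZ (subxx _) sH W4 mind.
set E := \sum_c _ => Eg.
apply: (@le_trans _ _ ((n.-1 - deg H u)%:R - E)).
  rewrite /E -[X in X - _](expect_cst (n.-1 - deg H u)%:R H) /expect -sumrB.
  apply: ler_sum => c _; rewrite -mulrBr ler_wpM2l ?weight_ge0 //.
  have := @hits_round _ (nbhd H u) u Z c H uZ; set h := hits _ _ _ _ => hH.
  have hZ : (#|h| <= #|Z|)%N.
    by apply/subset_leq_card/subsetP => z; rewrite inE => /andP[].
  have : (deg H u + #|h| <= deg (round H c) u)%N.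
    rewrite /deg -cardsUI (_ : _ :&: _ = set0) ?cards0 ?addn0.
      by apply/subset_leq_card; rewrite subUset hH nbhdS // sub_round.
    apply/setP => z; rewrite [LHS]inE [RHS]inE; apply/negP => /andP[zu].
    by rewrite inE !inE in zu * => /andP[]; rewrite zu orbT.
  by rewrite ZE in hZ; rewrite lerBrDr -natrD ler_nat; lia.
rewrite mulrBl mul1r lerD2l lerN2; apply: le_trans Eg.
apply: (@le_trans _ _ (2 / 9 * \sum_(x in nbhd H u) #|nbhd H x :&: Z|%:R / n%:R ^+ 2)); last first.
  rewrite ler_wpM2l ?divr_ge0 //; apply: ler_sum => x _; rewrite ler_wpM2l //.
  rewrite lef_pV2 ?posrE ?exprn_gt0 ?n0 ?ltr0n ?(leq_trans d0) //.
  by rewrite lerXn2r ?nnegrE // ler_nat -[X in (_ <= X)%N]card_ord max_card.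
rewrite -mulr_suml -natr_sum (sum_nbhdC _ _ sH) -ZE.
have : (#|Z| * d <= 2 * \sum_(z in Z) #|nbhd H z :&: nbhd H u|)%N.
  rewrite -sum_nat_const big_distrr /=; apply: leq_sum => z.
  rewrite inE => /(I2 _ _ IH); exact.
rewrite -(ler_nat R) !natrM; set r : R := #|Z|%:R; set S : R := (\sum_(z in Z) _)%:R => rS.
have n3R : (n%:R : R) <= 3 * d%:R by rewrite -natrM ler_nat.
have r0 : 0 <= r by rewrite /r.
by apply: fill_rate => //; nra.
Qed.

End Stages.

(** * One phase raises the minimum degree by 9/8; phases are then iterated *)

Section Phases.

Local Open Scope ring_scope.

Variables (R : realFieldType) (n : nat).
Implicit Types (G H K : graph n) (x y z u v w : 'I_n) (A B F W : {set 'I_n}).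
Implicit Types (c : {ffun 'I_n -> 'I_n * 'I_n}) (I : graph n -> Prop).

Definition super G H := simple_graph H /\ G \subset H.

Lemma simple_round G c : simple_graph G -> simple_graph (round G c).
Proof.
case=> irG symG; split=> [x|x y].
  rewrite inE negb_or irG inE; apply/existsPn => z.
  case: (c z) => a b /=; rewrite !xpair_eqE.
  by apply/negP => /andP[ab /orP[] /andP[/eqP xa /eqP xb]]; rewrite -xa -xb eqxx in ab.
rewrite !inE symG; congr (_ || _); apply: eq_existsb => z.
case: (c z) => a b /=; rewrite !xpair_eqE; congr (_ && _).
by rewrite orbC andbC [X in _ || X]andbC.
Qed.

Lemma stable_super G : stable (super G).
Proof.
move=> H c [sH GH]; split; first exact: simple_round.
exact: subset_trans GH (sub_round _ _).
Qed.

Lemma super_refl G : simple_graph G -> super G G.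
Proof. by []. Qed.

Lemma fails_sub I (D1 D2 : graph n -> bool) t G : stable I ->
  (forall H, I H -> D1 H -> D2 H) -> I G -> fails R t D2 G <= fails R t D1 G.
Proof.
move=> stI D12; apply: ler_expectn => // H IH; rewrite ler_nat.
by case: (D1 H) (D12 H IH) => [->|] //= _; rewrite leq_b1.
Qed.

(** Pads a stage for an absorbing goal to a prescribed number of rounds. *)
Lemma fails_later I (D : graph n -> bool) s t G : stable I ->
  (forall H c, I H -> D H -> D (round H c)) -> I G ->
  fails R (s + t) D G <= fails R s D G.
Proof.
move=> stI stD IG; rewrite -[X in _ <= X]addr0.
apply: (fails_seq (I := I) (D1 := D)) => // H IH DH.
by rewrite (fails_absorbing R (I := I)).
Qed.

Lemma fails_forall I (J : finType) (D : J -> graph n -> bool) t G : stable I ->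
  I G -> fails R t (fun H => [forall j, D j H]) G <= \sum_j fails R t (D j) G.
Proof.
move=> stI IG; rewrite /fails -expectn_sum.
apply: (ler_expectn (I := I)) => // H _; rewrite -natr_sum ler_nat.
have [//|/forallPn[j jD]] := boolP [forall j, D j H].
by rewrite (bigD1 j) //= jD.
Qed.

Lemma sub_of_card (T : finType) (A : {set T}) k : (k <= #|A|)%N ->
  exists2 B : {set T}, B \subset A & #|B| = k.
Proof.
case/card_geqP => s [us <- sA]; exists [set x in s].
  by apply/subsetP => x; rewrite inE => /sA.
by rewrite cardsE; apply/card_uniqP.
Qed.

Lemma connected_cross G A u w : connected_graph G -> u \in A -> w \notin A ->
  exists y z, [/\ y \in A, z \notin A & (y, z) \in G].
Proof.
move=> /(_ u w) /connectP[p + ->]; elim: p u => [|a p IHp] u /=.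
  by move=> _ ->.
case/andP=> ua pth uA; have [aA|aA] := boolP (a \in A); first exact: IHp.
by move=> _; exists u, a.
Qed.

Definition heavy d B v H := (d <= 8 * out H B v)%N.

Lemma heavyS d B v G H : G \subset H -> heavy d B v G -> heavy d B v H.
Proof. by move=> GH /leq_trans; apply; rewrite leq_mul2l outS. Qed.

(** The ratio increases with [o] and equals 1 / 33 at [o = d / 8]. *)
Lemma heavy_rate (d o : nat) : (0 < d)%N -> (d <= 8 * o)%N ->
  1 <= 33 * (o%:R / (o%:R + 4 * d%:R)) :> R.
Proof.
move=> d0; rewrite -(ler_nat R) natrM => d8.
have d0R : (0 : R) < d%:R by rewrite ltr0n.
rewrite mulrA ler_pdivlMr; lra.
Qed.

(** Either [v] already sees outside [B] and its outside neighbours introduce it further, or a heavy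
    neighbour [y] makes the first introduction. *)
Lemma spread_stage d B v t G : (0 < d)%N -> v \in B -> (#|B| <= 3 * d)%N ->
  simple_graph G -> (forall x, d <= deg G x)%N ->
  (forall x, x \notin B -> d <= 4 * out G B x)%N ->
  (0 < out G B v)%N \/
    (exists2 y, heavy d B y G & (y == v) || ((v, y) \in G)) ->
  fails R t (heavy d B v) G <= stage_failure R n t.
Proof.
move=> d0 vB B3 sG mind outB start.
apply: (growth_stage (I := super G)) => //; first exact: stable_super.
  by move=> H [sH GH]; split=> // x; apply: leq_trans (mind x) (degS _ GH).
move=> H [sH GH] p8; have [p0|p0] := posnP (out H B v); last first.
  (* Each such node has [d / 4] neighbours outside [B], fewer than [d / 8] of them adjacent to [v],
     so [d / 8] are fresh. The sum is then at least [out / 33], and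
     [2 * out + 1 <= 3 * out <= 240 / 33 * out]. *)
  exists (nbhd H v :\: B); first exact: subsetDl.
  rewrite /growing -/(out H B v).
  apply: (@le_trans _ _ (240 * \sum_(x in nbhd H v :\: B) 33^-1)); last first.
    rewrite ler_wpM2l //; apply: ler_sum => x; rewrite inE => /andP[xB _].
    have fx : (d <= 8 * fresh H B v x)%N.
      have h1 := outB x xB; have h2 := outS B x GH.
      have h3 : (out H B x <= fresh H B v x + out H B v)%N.
        rewrite /out /fresh; apply: leq_trans (leq_card_setU _ _).
        apply/subset_leq_card/subsetP => z; rewrite !inE.
        by case: (z \in B); case: (_ \in H); case: (_ \in H).
      lia.
    have := heavy_rate d0 fx; lra.
  rewrite sumr_const -/(out H B v) -natr1 -[X in _ <= _ * X]mulr_natr.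
  have : (1 : R) <= (out H B v)%:R by rewrite ler1n.
  lra.
case: start => [|[y hy]].
  by move=> /leq_trans/(_ (outS B v GH)); rewrite p0.
have [yv|yv /= vy] := eqVneq y v.
  by exfalso; move: hy; rewrite /heavy yv; have := outS B v GH; lia.
(* As [out H B v = 0], every neighbour of [y] outside [B] is fresh; the condition reads
   [2 <= 240 / 33]. *)
exists [set y]; first by rewrite sub1set inE (subsetP GH).
rewrite /growing big_set1 cards1 p0.
have fy : (d <= 8 * fresh H B v y)%N.
  rewrite /fresh (setUidPl _); first exact: heavyS hy.
  by move/eqP: p0; rewrite cards_eq0 setD_eq0.
have := heavy_rate d0 fy; lra.
Qed.

(** The second alternative covers saturation, when [9 * d / 8] exceeds the largest possible
    degree. *)
Definition phase_goal d u H := (9 * d <= 8 * deg H u)%N || (n.-1 <= deg H u)%N.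

Lemma phase_goal_round d u H c : phase_goal d u H -> phase_goal d u (round H c).
Proof.
have := degS u (sub_round H c); rewrite /phase_goal => le_deg.
by case/orP => h; apply/orP; [left|right]; lia.
Qed.

(** The [d] old neighbours lie in [B], so the [d / 8] neighbours outside [B] are additional. *)
Lemma heavy_phase_goal d u B G H : (d <= deg G u)%N -> nbhd G u \subset B ->
  G \subset H -> heavy d B u H -> phase_goal d u H.
Proof.
rewrite /heavy /phase_goal => du GB GH h; apply/orP; left.
have : (deg G u + out H B u <= deg H u)%N.
  rewrite /deg /out -(cardsID B (nbhd H u)) leq_add2r subset_leq_card //.
  by rewrite subsetI nbhdS.
lia.
Qed.

(** * A phase seen from one node of small degree *)

Section Node.

Variables (G : graph n) (u : 'I_n) (d : nat).
Hypotheses (sG : simple_graph G) (cG : connected_graph G) (d0 : (0 < d)%N).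
Hypotheses (mind : forall x, (d <= deg G x)%N) (small : (8 * deg G u < 9 * d)%N).

Let A : {set 'I_n} := u |: nbhd G u.
Let F0 : {set 'I_n} := [set w | (w \notin A) && (2 * out G A w < d)%N].

Let uA : u \in A. Proof. exact: setU11. Qed.

Let cardA : #|A| = (deg G u).+1.
Proof. by rewrite cardsU1 inE sG.1. Qed.

(** At least [d / 2] neighbours of [w] lie in [A]; none is [u], since [w] is outside [A], and the
    edges persist in [H]. *)
Let strong H w : super G H -> w \in F0 -> (d <= 2 * #|nbhd H w :&: nbhd G u|)%N.
Proof.
move=> [_ GH]; rewrite inE => /andP[wA o2].
have : (#|nbhd G w :&: nbhd G u| <= #|nbhd H w :&: nbhd G u|)%N.
  by apply/subset_leq_card/setSI/nbhdS.
have := mind w; rewrite /deg -(cardsID A) -/(out G A w).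
have -> : nbhd G w :&: A = nbhd G w :&: nbhd G u.
  apply/setP => z; rewrite in_setI [RHS]in_setI in_setU1.
  case: eqVneq => //= ->; rewrite !inE (negbTE (sG.1 u)) andbT andbF.
  by apply/negbTE; apply: contra wA; rewrite !inE sG.2 => ->; rewrite orbT.
lia.
Qed.

Let many_strong t : (d <= 4 * #|F0|)%N ->
  fails R t (phase_goal d u) G <= stage_failure R n t.
Proof.
move=> dF0.
(* The exact size, [d / 4] rounded up, keeps [o x <= d] below, so that
   [o / (o + 4 * d) >= o / (5 * d)]. *)
have [|F FF0 cF] := @sub_of_card _ F0 ((d + 3) %/ 4); first by lia.
have stI := @stable_super G.
apply: (le_trans (fails_sub (D1 := heavy d A u) t stI _ _)).
- by move=> H [_ GH]; apply: heavy_phase_goal GH; rewrite ?subsetUr.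
- exact: super_refl.
apply: (growth_stage (I := super G)) => //.
- by rewrite cardA; lia.
- by move=> H [sH GH]; split=> // x; apply: leq_trans (mind x) (degS _ GH).
move=> H GH p8; exists (nbhd G u); first exact: nbhdS GH.2.
pose o x := #|nbhd H x :&: (F :\: nbhd H u)|.
have cFD : (d <= 8 * #|F :\: nbhd H u|)%N.
  have := cardsID (nbhd H u) F.
  have : (#|F :&: nbhd H u| <= out H A u)%N.
    apply/subset_leq_card/subsetP => z /setIP[/(subsetP FF0)].
    by rewrite !inE => /andP[/negbTE -> _] ->.
  lia.
(* At least [d / 8] nodes of [F] are still not adjacent to [u], and each has [d / 2] neighbours in
   [nbhd G u]. *)
have so : (d * d <= 16 * \sum_(x in nbhd G u) o x)%N.
  rewrite (sum_nbhdC _ _ GH.1).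
  have : (#|F :\: nbhd H u| * d
      <= 2 * \sum_(z in F :\: nbhd H u) #|nbhd H z :&: nbhd G u|)%N.
    rewrite -sum_nat_const big_distrr /=; apply: leq_sum => z.
    by rewrite inE => /andP[_ /(subsetP FF0)]; exact: strong.
  nia.
have d0R : (0 : R) < d%:R by rewrite ltr0n.
rewrite /growing.
(* This case fixes the constant of [growing]: [240 * (d ^ 2 / 16) / (5 * d) = 3 * d]. *)
apply: (@le_trans _ _ (3 * d%:R)).
  by rewrite -/(deg G u) -natrD -natrM ler_nat; lia.
have terms : \sum_(x in nbhd G u) (o x)%:R / (5 * d%:R) <=
    \sum_(x in nbhd G u) (fresh H A u x)%:R / ((fresh H A u x)%:R + 4 * d%:R) :> R.
  apply: ler_sum => x _.
  have : (o x <= fresh H A u x)%N.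
    rewrite /o /fresh; apply/subset_leq_card/subsetP => z.
    move=> /setIP[zx /setDP[/(subsetP FF0)]]; rewrite inE => /andP[zA _] zu.
    by rewrite in_setD in_setU negb_or zA zu.
  have : (o x <= d)%N.
    apply: leq_trans (subset_leq_card (subsetIr _ _)) _.
    apply: leq_trans (subset_leq_card (subsetDl _ _)) _; lia.
  move: (o x) (fresh H A u x) => a b; rewrite -2!(ler_nat R).
  have : (0 : R) <= a%:R by [].
  move: (a%:R : R) (b%:R : R) => {}a {}b a0 ad ab.
  rewrite ler_pdivrMr ?mulr_gt0 // mulrAC ler_pdivlMr; nra.
move: terms; rewrite -mulr_suml -natr_sum; set S := (\sum_(x in _) o x)%N in so *.
move=> terms; apply: (@le_trans _ _ (240 * (S%:R / (5 * d%:R)))); last first.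
  by rewrite ler_wpM2l.
move: so; rewrite -(ler_nat R) !natrM; move: (S%:R : R) => s ds.
rewrite mulrA ler_pdivlMr ?mulr_gt0 //; nra.
Qed.

Let few_strong t : (4 * #|F0| < d)%N ->
  fails R (t + (t + t)) (phase_goal d u) G
    <= stage_failure R n t + (stage_failure R n t + stage_failure R n t).
Proof.
move=> dF0; set B := A :|: F0.
have stI := @stable_super G.
have GG := super_refl sG.
have f0 : 0 <= stage_failure R n t.
  by rewrite mulr_ge0 // exprn_ge0 // subr_ge0 rate_le1.
have B3 : (#|B| <= 3 * d)%N.
  by apply: leq_trans (leq_card_setU _ _) _; rewrite cardA; lia.
have uB : u \in B by rewrite inE uA.
have minH H : super G H -> forall x, (d <= deg H x)%N.
  by move=> [_ GH] x; apply: leq_trans (mind x) (degS _ GH).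
have [BT|/subsetPn[w _ wB]] := boolP ([set: 'I_n] \subset B).
  apply: le_trans (fails_later _ _ stI _ GG) _.
    by move=> H c _; apply: phase_goal_round.
  apply: (@le_trans _ _ (stage_failure R n t)); last by rewrite lerDl addr_ge0.
  apply: (le_trans (fails_sub (D1 := fun H => (n.-1 <= deg H u)%N) t stI _ GG)).
    by move=> H _ h; apply/orP; right.
  apply: (fill_stage R (d := d) t stI) => //.
  - by apply: leq_trans B3; rewrite -[X in (X <= _)%N]card_ord -cardsT subset_leq_card.
  - by move=> H GH; split; [exact: GH.1 | exact: minH].
  move=> H z GH zH; have : z \in F0.
    have := subsetP BT z (in_setT z); rewrite inE => /orP[|//] zA.
    by case/negP: zH; move: zA; apply/subsetP/setUS/nbhdS/GH.2.
  move/(strong GH)/leq_trans; apply; rewrite leq_mul2l /=.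
  by apply/subset_leq_card/setIS/nbhdS/GH.2.
have [y [z [yB zB yz]]] := connected_cross cG uB wB.
(* A walk from [y] through [x] to [u] inside [B]. Equalities are allowed, so the same three stages
   serve for [y] in [A], with [x = u], and for [y] in [F0], with [x] a common neighbour. *)
have [x [xB xy ux]] : exists x,
    [/\ x \in B, (y == x) || ((x, y) \in G) & (x == u) || ((u, x) \in G)].
  case/setUP: (yB) => [/setU1P[->|]|yF].
  - by exists u; rewrite !eqxx.
  - by rewrite inE => uy; exists u; rewrite eqxx uy orbT.
  have : (0 < #|nbhd G y :&: nbhd G u|)%N.
    by move: (strong GG yF) d0; move: #|_| => a; clear; lia.
  case/card_gt0P => x; rewrite !inE => /andP[yx ux].
  by exists x; rewrite !inE ux sG.2 yx !orbT.
(* A node outside [B] has [d / 2] neighbours outside [A], and removing [F0] costs fewer than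
   [d / 4]. *)
have outB v : v \notin B -> (d <= 4 * out G B v)%N.
  rewrite inE negb_or => /andP[vA vF].
  have : (d <= 2 * out G A v)%N.
    by rewrite leqNgt; apply: contra vF; rewrite [in X in X -> _]/= inE vA.
  have : (out G A v <= out G B v + #|F0|)%N.
    rewrite /out; apply: leq_trans (leq_card_setU _ _).
    apply/subset_leq_card/subsetP => a /setDP[aN aA].
    case aF: (a \in F0); rewrite in_setU aF ?orbT // orbF.
    by rewrite in_setD aN andbT /B in_setU negb_or aA aF.
  move: dF0; move: (out G A v) (out G B v) #|F0| => a b e; clear; lia.
have stage H v : super G H -> v \in B ->
    (0 < out H B v)%N \/ (exists2 y, heavy d B y H & (y == v) || ((v, y) \in H)) ->
    fails R t (heavy d B v) H <= stage_failure R n t.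
  move=> GH vB; apply: spread_stage (GH.1) _ _ => //; first exact: minH.
  by move=> a /outB/leq_trans; apply; rewrite leq_mul2l outS // GH.2.
have adj H v v' : super G H -> (v == v') || ((v', v) \in G) ->
    (v == v') || ((v', v) \in H).
  by move=> [_ /subsetP GH] /orP[->|/GH ->] //; rewrite orbT.
apply: (le_trans (fails_sub (D1 := heavy d B u) _ stI _ GG)).
  move=> H [_ GH]; apply: heavy_phase_goal GH => //.
  by apply: subset_trans (subsetUl _ _); apply: subsetUr.
apply: (fails_seq (I := super G) (D1 := heavy d B y)) => //; first exact: addr_ge0.
  apply: stage => //; left; apply/card_gt0P; exists z.
  by rewrite in_setD zB inE.
move=> H GH hy; apply: (fails_seq (I := super G) (D1 := heavy d B x)) => //.
  by apply: stage => //; right; exists y => //; exact: adj.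
move=> K GK hx; apply: stage => //; right; exists x => //; exact: adj.
Qed.

Lemma small_node_phase t :
  fails R (t + (t + t)) (phase_goal d u) G
    <= stage_failure R n t + (stage_failure R n t + stage_failure R n t).
Proof.
have [dF0|dF0] := leqP d (4 * #|F0|); last exact: few_strong.
have f0 : 0 <= stage_failure R n t.
  by rewrite mulr_ge0 // exprn_ge0 // subr_ge0 rate_le1.
apply: le_trans (fails_later _ _ (@stable_super G) _ (super_refl sG)) _.
  by move=> H c _; apply: phase_goal_round.
by apply: le_trans (many_strong t dF0) _; rewrite lerDl addr_ge0.
Qed.

End Node.

(** Union bound over the nodes; one of degree at least [9 * d / 8] has met its goal from the
    start. *)
Lemma phase G d t : simple_graph G -> connected_graph G -> (0 < d)%N ->
  (forall x, d <= deg G x)%N ->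
  fails R (t + (t + t)) (fun H => [forall u, phase_goal d u H]) G
    <= n%:R * (3 * stage_failure R n t).
Proof.
move=> sG cG d0 mind.
apply: le_trans (fails_forall _ _ (@stable_super G) (super_refl sG)) _.
rewrite mulr_natl -[X in _ *+ X]card_ord -sumr_const; apply: ler_sum => u _.
have -> : 3 * stage_failure R n t
    = stage_failure R n t + (stage_failure R n t + stage_failure R n t) by ring.
have [small|big] := ltnP (8 * deg G u) (9 * d); first exact: small_node_phase.
rewrite (fails_absorbing R _ (@stable_super G)) ?super_refl //.
- by rewrite !addr_ge0 // mulr_ge0 // exprn_ge0 // subr_ge0 rate_le1.
- by move=> H c _; apply: phase_goal_round.
- by rewrite /phase_goal big.
Qed.

Lemma complete_deg G : simple_graph G -> (forall x, n.-1 <= deg G x)%N ->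
  complete_graph G.
Proof.
move=> [irG _] big; apply/forallP => x; apply/forallP => y; apply/implyP => xy.
have /eqP NE : nbhd G x == [set~ x].
  rewrite eqEcard cardsC1 card_ord big andbT.
  by apply/subsetP => z; rewrite !inE; apply: contraTneq => ->; exact: irG.
have : y \in nbhd G x by rewrite NE !inE eq_sym.
by rewrite inE.
Qed.

Lemma connectedS G H : G \subset H -> connected_graph G -> connected_graph H.
Proof.
move=> /subsetP GH cG x y; apply: connect_sub (cG x y) => a b ab.
by apply/connect1/GH.
Qed.

(** Induction on the number of phases left; the last hypothesis says that [(9 / 8) ^ k * d] reaches
    [n - 1]. *)
Lemma phases k d t G : (2 <= n)%N -> simple_graph G -> connected_graph G ->
  (0 < d)%N -> (forall x, d <= deg G x)%N -> (8 ^ k * n.-1 <= 9 ^ k * d)%N ->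
  fails R (k * (t + (t + t))) (@complete_graph n) G
    <= k%:R * (n%:R * (3 * stage_failure R n t)).
Proof.
move=> n2; elim: k d G => [|k IHk] d G sG cG d0 mind kd.
  rewrite mul0r mul0n /fails /= complete_deg //.
  by move=> x; apply: leq_trans (mind x); rewrite !mul1n in kd.
have f0 : 0 <= stage_failure R n t.
  by rewrite mulr_ge0 // exprn_ge0 // subr_ge0 (rate_le1 _ (Ordinal n2)).
rewrite mulSn -natr1 addrC mulrDl mul1r.
apply: (fails_seq (I := super G) (@stable_super G) _ (super_refl sG)
  (phase t sG cG d0 mind)); first by do 3?apply: mulr_ge0.
move=> H GH /forallP goal.
(* The new degree bound is [9 * d / 8] rounded up, capped at saturation. *)
apply: (IHk (minn n.-1 ((9 * d + 7) %/ 8))); first exact: GH.1.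
- exact: connectedS GH.2 cG.
- by rewrite leq_min; lia.
- by move=> x; case/orP: (goal x); lia.
rewrite !expnS in kd.
have e89 : (8 ^ k <= 9 ^ k)%N by case: (k) => // j; rewrite leq_exp2r.
case: (leqP n.-1 ((9 * d + 7) %/ 8)) => _; first by rewrite leq_mul2r e89 orbT.
have : (9 * d <= 8 * ((9 * d + 7) %/ 8))%N by lia.
move: ((9 * d + 7) %/ 8)%N (8 ^ k)%N (9 ^ k)%N kd => e a b; nia.
Qed.

Lemma connected_deg G : (2 <= n)%N -> connected_graph G -> forall x, (0 < deg G x)%N.
Proof.
move=> n2 cG x.
have [w wx] : exists w, w \notin [set x].
  apply/existsP; rewrite -negb_forall; apply/negP => /forallP h.
  have : (#|[set: 'I_n]| <= #|[set x]|)%N.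
    by apply/subset_leq_card/subsetP => z _; apply: h.
  by rewrite cards1 cardsT card_ord; lia.
have [y [z [/set1P-> _ xz]]] := connected_cross cG (set11 x) wx.
by apply/card_gt0P; exists z; rewrite inE.
Qed.

Lemma process_failure k t T G : (2 <= n)%N -> simple_graph G -> connected_graph G ->
  (8 ^ k * n.-1 <= 9 ^ k)%N -> (k * (t + (t + t)) <= T)%N ->
  fails R T (@complete_graph n) G <= k%:R * (n%:R * (3 * stage_failure R n t)).
Proof.
move=> n2 sG cG kn /subnKC <-.
apply: le_trans (fails_later _ _ (@stable_super G) _ (super_refl sG)) _.
  move=> H c _ /forallP h; apply/forallP => x; apply/forallP => y.
  apply/implyP => xy; have /implyP/(_ xy) := forallP (h x) y.
  exact/subsetP/sub_round.
(* Connectedness on at least two nodes gives minimum degree 1 for the first phase. *)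
apply: (phases (d := 1)) => //; first exact: connected_deg.
by rewrite muln1.
Qed.

End Phases.

(** * Choice of the number of phases and of rounds per stage *)

Section Numerics.

Local Open Scope R_scope.

Lemma INR_ceil (x : R) : 0 <= x -> exists k : nat, x <= INR k <= x + 1.
Proof.
move=> x0; have [up1 up2] := archimed x.
have /IZN[k upk] : Z.le Z0 (up x) by apply: le_IZR; Lra.lra.
by exists k; rewrite INR_IZR_INZ -upk; Lra.lra.
Qed.

Lemma INR_expn (m k : nat) : INR (expn m k) = pow (INR m) k.
Proof. by elim: k => [|k IHk] //=; rewrite expnS mult_INR IHk. Qed.

Lemma pow_exp (x : R) (k : nat) : pow (exp x) k = exp (INR k * x).
Proof.
elim: k => [|k IHk]; first by rewrite Rmult_0_l exp_0.
by rewrite S_INR /= IHk -exp_plus; congr exp; Lra.lra.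
Qed.

(** From [exp (- (1 / 9)) >= 8 / 9] follows [9 / 8 >= exp (1 / 9)], hence
    [(9 / 8) ^ k >= exp (k / 9) >= n]. *)
Lemma phase_count (n k : nat) : (2 <= n)%N -> 9 * ln (INR n) <= INR k ->
  (8 ^ k * n.-1 <= 9 ^ k)%N.
Proof.
move=> n2 kn; have n0 : 0 < INR n by apply: lt_0_INR; apply/ssrnat.ltP/ltnW.
apply: (@leq_trans (8 ^ k * n)); first by rewrite leq_mul2l leq_pred orbT.
apply/ssrnat.leP/INR_le; rewrite mult_INR !INR_expn.
have -> : INR 9 = INR 8 * (9 / 8) by rewrite /=; Lra.lra.
rewrite Rpow_mult_distr; apply: Rmult_le_compat_l.
  by apply/pow_le/pos_INR.
apply: (Rle_trans _ (pow (exp (1 / 9)) k)).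
  rewrite pow_exp -{1}(exp_ln _ n0); apply: Rle_trans (_ : exp (INR k * (1 / 9)) <= _).
    by case: (Rle_lt_or_eq_dec (ln (INR n)) (INR k * (1 / 9)));
       [Lra.lra | move/exp_increasing/Rlt_le | move=> ->; apply: Rle_refl].
  exact: Rle_refl.
apply: pow_incr; split; first exact/Rlt_le/exp_pos.
have := exp_ineq1_le (- (1 / 9)); rewrite exp_Ropp => h.
have e0 := exp_pos (1 / 9).
have := Rmult_le_compat_r _ _ _ (Rlt_le _ _ e0) h.
by rewrite Rinv_l; Lra.lra.
Qed.

(** 3240 is 3 * 1080: the power is at most [exp (- 3 * ln n) = n ^ -3]. The resulting [n ^ -2]
    leaves room for the union bound over nodes. *)
Lemma stage_length (n t : nat) : (2 <= n)%N ->
  3240 * INR n * ln (INR n) <= INR t ->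
  INR n * pow (1 - / (1080 * INR n)) t <= / INR n * / INR n.
Proof.
move=> n2 tn; have n2R : 2 <= INR n by have /ssrnat.leP/le_INR := n2.
have n0 : 0 < INR n by Lra.lra.
have e1 : INR n * / INR n = 1 by apply: Rinv_r; Lra.lra.
have i0 : 0 < / (1080 * INR n) by apply: Rinv_0_lt_compat; Lra.lra.
have i1 : / (1080 * INR n) <= 1.
  by rewrite -Rinv_1; apply: Rinv_le_contravar; Lra.lra.
have le_exp : pow (1 - / (1080 * INR n)) t <= exp (- (3 * ln (INR n))).
  apply: (Rle_trans _ (pow (exp (- / (1080 * INR n))) t)).
    apply: pow_incr; split; first by Lra.lra.
    by have := exp_ineq1_le (- / (1080 * INR n)); Lra.lra.
  rewrite pow_exp.
  have le3 : INR t * - / (1080 * INR n) <= - (3 * ln (INR n)).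
    have h : 3 * ln (INR n) = 3240 * INR n * ln (INR n) * / (1080 * INR n).
      rewrite Rinv_mult; transitivity (3 * ln (INR n) * (INR n * / INR n)).
        by rewrite e1 Rmult_1_r.
      by Lra.lra.
    rewrite h; have := Rmult_le_compat_r _ _ _ (Rlt_le _ _ i0) tn; Lra.lra.
  by case: le3 => [/exp_increasing/Rlt_le | ->] //; apply: Rle_refl.
apply: Rle_trans (Rmult_le_compat_l _ _ _ (Rlt_le _ _ n0) le_exp) _.
rewrite exp_Ropp; have -> : 3 * ln (INR n) = INR 3 * ln (INR n) by rewrite /=; Lra.lra.
rewrite -pow_exp exp_ln //; right; rewrite /= !Rinv_mult Rinv_1 Rmult_1_r.
by rewrite -Rmult_assoc e1 Rmult_1_l.
Qed.

(* 106953 = 3 * 11 * 3241: three stages per phase, at most 11 ln n phases, and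
   at most 3241 n ln n rounds per stage. *)
Lemma schedule (n T : nat) : (2 <= n)%N ->
  106953 * INR n * pow (ln (INR n)) 2 <= INR T ->
  exists k t : nat, [/\ (8 ^ k * n.-1 <= 9 ^ k)%N, (k * (t + (t + t)) <= T)%N &
    INR k * (INR n * (3 * (INR n * pow (1 - / (1080 * INR n)) t)))
      <= 33 * ln (INR n) / INR n].
Proof.
move=> n2 nT; have n2R : 2 <= INR n by have /ssrnat.leP/le_INR := n2.
have n0 : 0 < INR n by Lra.lra.
(* This lower bound lets [2 * l] and [INR n * l] absorb the 1 lost in each rounding up. *)
have l2 : / 2 < ln (INR n).
  apply: (Rlt_le_trans _ (ln 2)); first exact: ln_lt_2.
  by case: n2R => [/(ln_increasing 2)|<-]; [move=> h; apply/Rlt_le/h; Lra.lra | apply: Rle_refl].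
set l := ln (INR n) in nT l2 *.
have [k [k1 k2]] := @INR_ceil (9 * l) ltac:(Lra.lra).
have [t [t1 t2]] := @INR_ceil (3240 * INR n * l) ltac:(Lra.nra).
exists k, t; split.
- exact: phase_count.
- apply/ssrnat.leP/INR_le; rewrite mult_INR !plus_INR.
  apply: Rle_trans nT; rewrite /= Rmult_1_r.
  have kl : INR k <= 11 * l by Lra.lra.
  have tl : INR t <= 3241 * (INR n * l) by Lra.nra.
  have := Rmult_le_compat _ _ _ _ (pos_INR k) (pos_INR t) kl tl; Lra.lra.
have := stage_length n2 t1; set p := INR n * pow _ _ => pn.
have kl : INR k <= 11 * l by Lra.lra.
have -> : 33 * l / INR n = 11 * l * (INR n * (3 * (/ INR n * / INR n))).
  rewrite /Rdiv; transitivity (33 * l * (INR n * / INR n) * / INR n); last by Lra.lra.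
  by rewrite Rinv_r ?Rmult_1_r //; Lra.lra.
apply: (Rle_trans _ (INR k * (INR n * (3 * (/ INR n * / INR n))))).
  apply: Rmult_le_compat_l; first exact: pos_INR.
  by apply: Rmult_le_compat_l; Lra.lra.
apply: Rmult_le_compat_r kl.
have i0 := Rinv_0_lt_compat _ n0.
by repeat apply: Rmult_le_pos; Lra.lra.
Qed.

End Numerics.

(** * Transfer to the standard real numbers *)

Section Specialization.

Local Open Scope ring_scope.

Lemma pick_probE n (G : graph n) x p : pick_prob G x p = pickR R G x p.
Proof. by rewrite /pick_prob /pickR RinvE RmultE INRE. Qed.

Lemma prob_completeE n t (G : graph n) :
  prob_complete t G = iter t (@expect R n) (fun H => (complete_graph H)%:R) G.
Proof.
elim: t G => [|t IHt] G /=; first by case: complete_graph.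
apply: eq_bigr => c _; rewrite IHt; congr (_ * _).
by apply: eq_bigr => x _; rewrite pick_probE.
Qed.

Lemma prob_complete_fails n t (G : graph n) :
  prob_complete t G = 1 - fails R t (@complete_graph n) G.
Proof.
apply/eqP; rewrite eq_sym subr_eq prob_completeE /fails -expectnD; apply/eqP.
rewrite -[LHS](expectn_cst t 1 G); elim: t G => [|t IHt] G.
  by rewrite /=; case: complete_graph; rewrite ?addr0 ?add0r.
by rewrite !iterS; apply: eq_bigr => c _; rewrite IHt.
Qed.

End Specialization.

Theorem theorem8 :
  exists C C' : R, Rlt R0 C /\ Rlt R0 C' /\
  forall (n : nat), (2 <= n)%N ->
  forall G0 : graph n, simple_graph G0 -> connected_graph G0 ->
  forall T : nat,
    Rle (Rmult (Rmult C (INR n)) (pow (ln (INR n)) 2)) (INR T) ->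
    Rlt (INR T) (Rplus (Rmult (Rmult C (INR n)) (pow (ln (INR n)) 2)) R1) ->
    Rle (Rminus R1 (Rdiv (Rmult C' (ln (INR n))) (INR n))) (prob_complete T G0).
Proof.
exists (IZR 106953), (IZR 33); split; first by Lra.lra.
split=> [|n n2 G sG cG T nT _]; first by Lra.lra.
have [k [t [kn tT bound]]] := schedule n2 nT.
have /RleP le_fails := process_failure R n2 sG cG kn tT.
suff : Rle (fails R T (@complete_graph n) G)
           (Rdiv (Rmult (IZR 33) (ln (INR n))) (INR n)).
  move=> le_fail; rewrite prob_complete_fails.
  exact: Rplus_le_compat_l (Ropp_le_contravar _ _ le_fail).
apply: Rle_trans le_fails _; apply: Rle_trans bound; right.
(* The two sides differ only in how numerals and powers are encoded: standard real literals against
   natural-number multiples of the ring unit. *)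
have lit p : IZR (Z.pos p) = (nat_of_pos p)%:R%R by rewrite IZRposE INRE.
by rewrite /stage_failure !INRE RpowE (lit 3%positive) (lit 1080%positive).
Qed.
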